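(* For every integer $m\ge 1$, $\ \overline{dc}(\mathrm{perm}_m)\ \geq\ \dfrac{m^2}{2}$.
   Context: $M_n(\mathbb C)$ is the space of complex $n\times n$ matrices; $\det_n$ is the determinant, an element of $S^n(M_n(\mathbb C))^*$, the space of homogeneous polynomials of degree $n$ on $M_n(\mathbb C)$. The group $GL_{n^2}=GL(M_n(\mathbb C))$ acts on polynomials on $M_n(\mathbb C)$ by linear changes of variables. $\overline{GL_{n^2}\cdot[\det_n]}\subset \mathbb P(S^n(M_n(\mathbb C))^* )$ is the Zariski closure of the orbit of the point $[\det_n]$. $\mathrm{perm}_m(X)=\sum_{\sigma\in\mathfrak S_m}x_{1\sigma(1)}\cdots x_{m\sigma(m)}$ is the permanent of an $m\times m$ matrix. For $n>m$, let $\ell$ be a linear coordinate on $\mathbb C$ and choose a linear inclusion $\mathbb C\oplus M_m(\mathbb C)\subset M_n(\mathbb C)$; view $\ell^{n-m}\mathrm{perm}_m$ as a degree $n$ form on $M_n(\mathbb C)$ (i.e. $\ell$ and the $m^2$ matrix entries are taken to be linearly independent linear forms on $M_n(\mathbb C)$). For $n=m$ the polynomial is $\mathrm{perm}_m$ itself on $M_m(\mathbb C)$. Whether $[\ell^{n-m}\mathrm{perm}_m]$ lies in $\overline{GL_{n^2}\cdot[\det_n]}$ does not depend on the choices. $\overline{dc}(\mathrm{perm}_m)$ is the smallest $n\ge m$ such that $[\ell^{n-m}\mathrm{perm}_m]\in\overline{GL_{n^2}\cdot[\det_n]}$. *)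

(* Defs.v *)
From HB Require Import structures.
From mathcomp Require Import all_boot all_order all_fingroup all_algebra.
From mathcomp Require Import reals.
From mathcomp Require Import complex.
From mathcomp.multinomials Require Import mpoly.

Set Implicit Arguments.
Unset Strict Implicit.
Unset Printing Implicit Defensive.

Import GRing.Theory Num.Theory.
Local Open Scope ring_scope.

(* A polynomial function on 'M[F]_n is an element of {mpoly F[n * n]}: the
   variable of index mxvec_index i j is the (i, j) entry.  A linear form is
   given by its row vector of coefficients. *)

Definition linear_form (F : fieldType) (N : nat) (a : 'rV[F]_N) : {mpoly F[N]} :=
  \sum_(k < N) a 0 k *: 'X_k.

(* Row i of A gives the linear form substituted for the i-th variable of p. *)
Definition linear_subst (F : fieldType) (M N : nat) (A : 'M[F]_(M, N))
    (p : {mpoly F[M]}) : {mpoly F[N]} :=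
  p \mPo [tuple linear_form (row i A) | i < M].

Definition generic_mx (F : fieldType) (n : nat) : 'M[{mpoly F[n * n]}]_n :=
  \matrix_(i, j) 'X_(mxvec_index i j).

Definition permanent (K : comPzRingType) (m : nat) (A : 'M[K]_m) : K :=
  \sum_(s : 'S_m) \prod_(i < m) A i (s i).

Definition det_poly (F : fieldType) (n : nat) : {mpoly F[n * n]} :=
  \det (generic_mx F n).

Definition perm_poly (F : fieldType) (m : nat) : {mpoly F[m * m]} :=
  permanent (generic_mx F m).

(* Points of P(S^d) are represented by nonzero homogeneous polynomials of
   degree d, and subsets of P(S^d) by the cones of their representatives. *)
Definition proj_point (F : fieldType) (N d : nat) (f : {mpoly F[N]}) : Prop :=
  f != 0 /\ f \is d.-homog.

(* The coefficients of the monomials of degree at most d are the coordinates;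
   on S^d those of degree less than d vanish, so that every polynomial
   function on S^d is of the form coef_eval d P. *)
Definition coef_eval (F : fieldType) (N d : nat)
    (P : {mpoly F[#|{: 'X_{1..N < d.+1}}|]}) (f : {mpoly F[N]}) : F :=
  P.@[fun k => f@_(enum_val k : 'X_{1..N < d.+1})].

Definition proj_closed (F : fieldType) (N d : nat)
    (Z : {mpoly F[N]} -> Prop) : Prop :=
  exists E : {mpoly F[#|{: 'X_{1..N < d.+1}}|]} -> Prop,
    (forall P, E P -> exists e : nat, P \is e.-homog) /\
    (forall f, Z f <-> proj_point d f /\ forall P, E P -> coef_eval P f = 0).

Definition zariski_closure (F : fieldType) (N d : nat)
    (Y : {mpoly F[N]} -> Prop) (f : {mpoly F[N]}) : Prop :=
  forall Z, proj_closed d Z -> (forall h, Y h -> Z h) -> Z f.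

(* Representatives of the points g . [p], for g in GL_N. *)
Definition proj_orbit (F : fieldType) (N : nat) (p f : {mpoly F[N]}) : Prop :=
  exists (g : 'M[F]_N) (c : F),
    [/\ g \in unitmx, c != 0 & f = c *: linear_subst g p].

(* For m < n, the rows of l and A are the linear forms on 'M_n playing the
   roles of the linear coordinate and of the matrix entries. *)
Inductive padded_perm (F : fieldType) (m : nat) :
    forall n : nat, {mpoly F[n * n]} -> Prop :=
| PaddedPermEq : @padded_perm F m m (perm_poly F m)
| PaddedPermLt (n : nat) (l : 'rV[F]_(n * n)) (A : 'M[F]_(m * m, n * n)) :
    (m < n)%N -> row_free (col_mx l A) ->
    @padded_perm F m n
      (linear_form l ^+ (n - m) * linear_subst A (perm_poly F m)).

(* The orbit closure is GL-invariant, so any choice of l and A is as good as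
   any other. *)
Definition perm_in_det_closure (F : fieldType) (m n : nat) : Prop :=
  exists2 f : {mpoly F[n * n]},
    padded_perm m f & zariski_closure n (proj_orbit (det_poly F n)) f.

Definition is_border_dc_perm (F : fieldType) (m n : nat) : Prop :=
  [/\ (m <= n)%N, perm_in_det_closure F m n &
      forall k : nat, (m <= k)%N -> perm_in_det_closure F m k -> (n <= k)%N].

(* Main.v *)
(* Every form P in the orbit of det_n has the property that P divides the k x k
   minors of its Hessian as soon as k > 2n.  This property passes to the closure,
   because divisibility on a line x + t y with P(y) <> 0 is the vanishing of a
   pseudo-remainder, whose coefficients are polynomials in those of P.  On the
   other hand (Mignon-Ressayre), perm_m has a zero at which its Hessian has full
   rank m^2, and so does the padded permanent in the directions of the m^2 matrix
   entries, on the hyperplane l = 1; hence m^2 <= 2n. *)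

From HB Require Import structures.
Require Import Defs.
From mathcomp Require Import all_boot all_order all_fingroup all_algebra.
From mathcomp Require Import reals complex.
From mathcomp Require Import ring zify.
From mathcomp.multinomials Require Import mpoly.
From mathcomp.real_closed Require Import mxtens.

Set Implicit Arguments.
Unset Strict Implicit.
Unset Printing Implicit Defensive.

Import GRing.Theory Num.Theory.
Local Open Scope ring_scope.

(** * Determinants of structured matrices *)

(** The threshold 2n comes from an explicit scaled inverse of the Hessian of det_n. This matrix
    [codet_hess X] is congruent to its value at the identity through the operator Y |-> X Y, whose
    determinant is (det X)^n; so its own determinant is a constant times (det X)^(2n), and the
    constant is nonzero as soon as n - 1 is. A bound on the rank of the Hessian at the zeros of P
    would quantify over those zeros; divisibility can be phrased by equations in the coefficients of
    P alone. The obstacle is that the degree of P on a line may drop for some members of the orbit.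
    The division is therefore carried out with a fixed formal degree, and its equations are
    multiplied by the coefficient of t^n on the line, which is P(y): they then hold on the whole
    orbit, and the factor can be removed at a limit form with P(y) <> 0. Closed sets of a projective
    space are given by homogeneous equations, so the degrees in the coefficients have to be followed
    through the division. *)

Lemma mpoly_alg_ind (F : comNzRingType) (N : nat) (Q : {mpoly F[N]} -> Prop) :
  Q 1 -> (forall i, Q 'X_i) -> (forall c p, Q p -> Q (c *: p)) ->
  (forall p q, Q p -> Q q -> Q (p + q)) ->
  (forall p q, Q p -> Q q -> Q (p * q)) -> forall p, Q p.
Proof.
move=> Q1 QX QZ QD QM; elim/mpolyind => [|c mon p _ _ Qp].
  by rewrite -(scale0r 1); apply: QZ.
apply: QD => //; apply: QZ; rewrite mpolyXE_id; apply: (big_ind Q) => // i _.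
by elim: (mon i) => [|e IHe]; rewrite ?expr0 // exprS; apply: QM.
Qed.

Lemma det_reindex (R : comPzRingType) (M N : nat) (f : 'I_M -> 'I_N)
    (A : 'M[R]_N) :
  bijective f -> \det (\matrix_(i, j) A (f i) (f j)) = \det A.
Proof.
move=> bij_f; have eqMN : M = N by rewrite -(card_ord M) -(card_ord N) (bij_eq_card bij_f).
case: N / eqMN in f A bij_f *.
pose s := perm (bij_inj bij_f).
have -> : \matrix_(i, j) A (f i) (f j) = row_perm s (col_perm s A).
  by apply/matrixP=> i j; rewrite !mxE !permE.
rewrite row_permE col_permE !det_mulmx !det_perm odd_permV.
by rewrite mulrCA -signr_addb addbb mulr1.
Qed.

Lemma det_tens1mx (R : comPzRingType) (k n : nat) (A : 'M[R]_n) :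
  \det ((1%:M : 'M[R]_k) *t A) = \det A ^+ k.
Proof.
elim: k => [|k IHk]; first by rewrite det_mx00.
have lE i : lshift (k * n) i = mxtens_index (ord0 : 'I_k.+1, i) :> 'I_(n + k * n).
  by apply: val_inj.
have rE (ij : 'I_k * 'I_n) : rshift n (mxtens_index ij)
    = mxtens_index (lift ord0 ij.1, ij.2) :> 'I_(n + k * n).
  by apply: val_inj; rewrite /= mulSn addnA.
have -> : (1%:M : 'M[R]_k.+1) *t A =
    block_mx A 0 0 ((1%:M : 'M[R]_k) *t A) :> 'M_(n + k * n).
  apply/matrixP=> i j.
  case: (split_ordP i) => {}i ->; case: (split_ordP j) => {}j ->.
  - rewrite block_mxEul !lE; apply: etrans (tensmxE _ _ _ _ _ _) _.
    by rewrite mxE eqxx mul1r.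
  - case: (mxtens_indexP j) => j0 j1.
    rewrite block_mxEur lE rE; apply: etrans (tensmxE _ _ _ _ _ _) _.
    by rewrite !mxE mul0r.
  - case: (mxtens_indexP i) => i0 i1.
    rewrite block_mxEdl lE rE; apply: etrans (tensmxE _ _ _ _ _ _) _.
    by rewrite !mxE mul0r.
  case: (mxtens_indexP i) => i0 i1; case: (mxtens_indexP j) => j0 j1.
  rewrite block_mxEdr !rE; apply: etrans (tensmxE _ _ _ _ _ _) _.
  by rewrite tensmxE !mxE (inj_eq lift_inj).
by rewrite det_ublock IHk exprS.
Qed.

Definition mxvec_unindex (m n : nat) (k : 'I_(m * n)) : 'I_m * 'I_n :=
  enum_val (cast_ord (esym (mxvec_cast m n)) k).

Lemma mxvec_indexK (m n : nat) (i : 'I_m) (j : 'I_n) :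
  mxvec_unindex (mxvec_index i j) = (i, j).
Proof. by rewrite /mxvec_unindex /mxvec_index cast_ordK enum_rankK. Qed.

Lemma mxvec_unindexK (m n : nat) (k : 'I_(m * n)) :
  mxvec_index (mxvec_unindex k).1 (mxvec_unindex k).2 = k.
Proof. by case/mxvec_indexP: k => i j; rewrite mxvec_indexK. Qed.

Lemma sum_mxvec (V : nmodType) (m n : nat) (f : 'I_(m * n) -> V) :
  \sum_k f k = \sum_i \sum_j f (mxvec_index i j).
Proof.
rewrite pair_bigA /= (reindex (fun ij : 'I_m * 'I_n => mxvec_index ij.1 ij.2)) //=.
by exists (@mxvec_unindex m n) => [[i j]|k] _ /=; rewrite (mxvec_indexK, mxvec_unindexK).
Qed.

Section DetHessian.
Variables (R : comPzRingType) (n : nat).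

(** The matrix of Y |-> A Y on n x n matrices; up to reindexing it is [1%:M *t A]. *)
Definition lmul_mx (A : 'M[R]_n) : 'M[R]_(n * n) :=
  \matrix_(u, v) (A (mxvec_unindex u).1 (mxvec_unindex v).1
                  *+ ((mxvec_unindex u).2 == (mxvec_unindex v).2)).

Lemma det_lmul_mx (A : 'M[R]_n) : \det (lmul_mx A) = \det A ^+ n.
Proof.
rewrite -det_tens1mx.
pose f (k : 'I_(n * n)) := mxtens_index ((mxvec_unindex k).2, (mxvec_unindex k).1).
rewrite -(@det_reindex _ _ _ f (_ *t A)); last first.
  exists (fun k => mxvec_index (mxtens_unindex k).2 (mxtens_unindex k).1) => k.
    by rewrite /f mxtens_indexK /= mxvec_unindexK.
  by rewrite /f mxvec_indexK; apply: mxtens_unindexK.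
congr (\det _); apply/matrixP=> u v; by rewrite [RHS]mxE tensmxE !mxE mulr_natl.
Qed.

(* Up to the factor (n - 1) det X, this is the inverse of the Hessian of the
   determinant at X. *)
Definition codet_hess (X : 'M[R]_n) : 'M[R]_(n * n) :=
  \matrix_(u, v) let: (i, j) := mxvec_unindex u in
                 let: (k, l) := mxvec_unindex v in
    X i j * X k l - (X i l * X k j) *+ n.-1.

(** In both products of [codet_hess] the row indices i and k sit in different factors, so each
    product is a sum over a and c of [X i a * X k c] times the same product for the identity. Left
    multiplication acts on row indices only. *)
Lemma codet_hess_lmul (X : 'M[R]_n) :
  codet_hess X = lmul_mx X *m codet_hess 1%:M *m (lmul_mx X)^T.
Proof.
apply/matrixP=> u v; case/mxvec_indexP: u => i j; case/mxvec_indexP: v => k l.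
rewrite !mxE !mxvec_indexK sum_mxvec.
transitivity (\sum_c \sum_a (X i a * X k c)
     * ((a == j)%:R * (c == l)%:R - ((a == l)%:R * (c == j)%:R) *+ n.-1)).
  under eq_bigr do under eq_bigr do rewrite mulrBr.
  rewrite exchange_big /=.
  under eq_bigr do rewrite sumrB.
  rewrite sumrB; congr (_ - _).
    rewrite (bigD1 j) //= [X in _ + X]big1 ?addr0 => [|a /negbTE ne]; last first.
      by apply: big1 => c _; rewrite ne mul0r mulr0.
    rewrite (bigD1 l) //= big1 ?addr0 => [|a /negbTE ne]; last first.
      by rewrite ne !mulr0.
    by rewrite !eqxx !mulr1.
  rewrite (bigD1 l) //= [X in _ + X]big1 ?addr0 => [|a /negbTE ne]; last first.
    by apply: big1 => c _; rewrite ne mul0r mul0rn mulr0.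
  rewrite (bigD1 j) //= big1 ?addr0 => [|a /negbTE ne]; last first.
    by rewrite ne mulr0 mul0rn mulr0.
  by rewrite !eqxx !mulr1 mulrnAr mulr1.
apply: eq_bigr => c _.
rewrite [X in _ = X](bigD1 l) //= [X in _ = _ + X]big1 ?addr0 => [|d /negbTE ne]; last first.
  by rewrite !mxE !mxvec_indexK /= eq_sym ne mulr0.
rewrite !mxE !mxvec_indexK /= eqxx mulr1n sum_mxvec mulr_suml.
apply: eq_bigr => a _.
rewrite [X in _ = X * _](bigD1 j) //= [X in _ = (_ + X) * _]big1 ?addr0 => [|d /negbTE ne]; last first.
  by rewrite !mxE !mxvec_indexK /= eq_sym ne mul0r.
rewrite !mxE !mxvec_indexK /= eqxx mulr1n.
by rewrite [RHS]mulrAC !mxE.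
Qed.

Lemma det_codet_hess (X : 'M[R]_n) :
  \det (codet_hess X) = \det X ^+ n.*2 * \det (codet_hess 1%:M).
Proof.
rewrite codet_hess_lmul !det_mulmx det_tr det_lmul_mx.
by rewrite mulrAC -exprD addnn.
Qed.

End DetHessian.

Lemma map_codet_hess (R S : comPzRingType) (f : {rmorphism R -> S}) (n : nat)
    (X : 'M[R]_n) :
  codet_hess (map_mx f X) = map_mx f (codet_hess X).
Proof.
apply/matrixP=> u v; rewrite !mxE.
case: (mxvec_unindex u) => i j; case: (mxvec_unindex v) => k l.
by rewrite !mxE rmorphB rmorphMn !rmorphM.
Qed.

(** * The Hessian of the determinant *)

Section DetDerivatives.
Variables (F : comNzRingType) (N : nat).
Implicit Types (v : 'I_N).

Lemma mderiv_det_eq0 (n : nat) (A : 'M[{mpoly F[N]}]_n) v :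
  (forall i j, (A i j)^`M(v) = 0) -> (\det A)^`M(v) = 0.
Proof.
move=> dA; rewrite /determinant raddf_sum big1 //= => s _.
rewrite -signr_odd mulr_sign (fun_if (mderiv v)) mderivN.
suff -> : (\prod_i A i (s i))^`M(v) = 0 by rewrite oppr0 if_same.
apply: (big_ind (fun p => p^`M(v) = 0)) => // [|p q dp dq].
  by rewrite -mpolyC1 mderivC.
by rewrite mderivM dp dq mul0r mulr0 addr0.
Qed.

Lemma mderiv_mulmx (m n p : nat) (A : 'M[{mpoly F[N]}]_(m, n)) (B : 'M_(n, p)) v :
  map_mx (mderiv v) (A *m B) = map_mx (mderiv v) A *m B + A *m map_mx (mderiv v) B.
Proof.
apply/matrixP=> i j; rewrite !mxE raddf_sum -big_split /=.
by apply: eq_bigr => k _; rewrite !mxE mderivM.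
Qed.

End DetDerivatives.

(** One summand of [D] times an entry of [hess D *m codet_hess GX], grouped so that summing over k
    turns each parenthesized product into an entry of [\adj GX *m GX]. *)
Fact hess_codet_term (R : comPzRingType) (aij akl ail akj xpq xkl xpl xkq : R) e :
  (aij * akl - ail * akj) * (xkl * xpq - xkq * xpl *+ e) =
  aij * xpq * (akl * xkl) - aij * xpl * (akl * xkq) *+ e
  - xpq * ail * (akj * xkl) + xpl * ail * (akj * xkq) *+ e.
Proof. by ring. Qed.

Section DetPolyHessian.
Variables (F : fieldType) (n : nat).
Local Notation GX := (generic_mx F n).
Local Notation D := (det_poly F n).

Lemma mderiv_mpolyXU (N : nat) (i j : 'I_N) :
  ('X_i : {mpoly F[N]})^`M(j) = (i == j)%:R.
Proof.
rewrite mderivX mnm1E; case: eqP => [->|_]; last by rewrite scale0r.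
rewrite scale1r (_ : (U_(j) - U_(j))%MM = 0%MM) ?mpolyX0 //.
by apply/mnmP=> a; rewrite mnmBE subnn mnm0E.
Qed.

Lemma eq_mxvec_index (i j k l : 'I_n) :
  (mxvec_index i j == mxvec_index k l) = (i == k) && (j == l).
Proof.
apply/eqP/andP => [eq_u | [/eqP -> /eqP ->] //].
have := congr1 (@mxvec_unindex n n) eq_u.
by rewrite !mxvec_indexK => -[-> ->]; rewrite !eqxx.
Qed.

Lemma mderiv_generic_mx (k l : 'I_n) :
  map_mx (mderiv (mxvec_index k l)) GX = delta_mx k l.
Proof.
by apply/matrixP=> i j; rewrite !mxE mderiv_mpolyXU eq_mxvec_index.
Qed.

Lemma mderiv_det_poly (k l : 'I_n) :
  D^`M(mxvec_index k l) = \adj GX l k.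
Proof.
have dX i j : (GX i j)^`M(mxvec_index k l) = ((i == k) && (j == l))%:R.
  by have /matrixP/(_ i j) := mderiv_generic_mx k l; rewrite !mxE.
have dcof j : (cofactor GX k j)^`M(mxvec_index k l) = 0.
  rewrite /cofactor -signr_odd mulr_sign (fun_if (mderiv _)) mderivN.
  rewrite mderiv_det_eq0 ?oppr0 ?if_same // => a b.
  by rewrite mxE [col' _ _ _ _]mxE dX eq_sym (negbTE (neq_lift _ _)).
rewrite /det_poly (expand_det_row GX k) raddf_sum (bigD1 l) //= big1 => [|j ne_jl].
  by rewrite addr0 mderivM dX dcof !eqxx mul1r mulr0 addr0 mxE.
by rewrite mderivM dX dcof (negbTE ne_jl) andbF mul0r mulr0 addr0.
Qed.

(** Jacobi's identity for second-order minors, obtained by differentiating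
    [GX *m \adj GX = (\det GX)%:M] and multiplying by [\adj GX] on the left. *)
Lemma det_poly_hess (i j k l : 'I_n) :
  D * D^`M(mxvec_index i j)^`M(mxvec_index k l) =
  \adj GX j i * \adj GX l k - \adj GX l i * \adj GX j k.
Proof.
rewrite mderiv_det_poly.
have := congr1 (map_mx (mderiv (mxvec_index k l))) (mul_mx_adj GX).
rewrite mderiv_mulmx mderiv_generic_mx => /(congr1 (mulmx (\adj GX))).
rewrite mulmxDr mulmxA [in X in _ + X]mulmxA mul_adj_mx mul_scalar_mx.
have -> : map_mx (mderiv (mxvec_index k l)) ((\det GX)%:M : 'M_n) = (\adj GX l k)%:M.
  apply/matrixP=> a b; rewrite !mxE; case: (a == b); last by rewrite !mulr0n mderiv0.
  by rewrite !mulr1n -/(det_poly F n) mderiv_det_poly mxE.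
move/matrixP/(_ j i); rewrite mul_mx_scalar.
rewrite 2!mxE [in X in _ + X]mxE [in X in _ + X]mxE [in X in _ = X]mxE => eq_adj.
apply/eqP; rewrite eq_sym subr_eq addrC mulrC -eq_adj; apply/eqP.
congr (_ + _).
rewrite (bigD1 l) //= [X in _ + X]big1 ?addr0 => [|c ne_cl]; last first.
  rewrite mxE big1 ?mul0r // => d _.
  by rewrite [delta_mx _ _ _ _]mxE (negbTE ne_cl) andbF mulr0.
rewrite mxE (bigD1 k) //= big1 ?addr0 => [|c ne_ck]; last first.
  by rewrite [delta_mx _ _ _ _]mxE (negbTE ne_ck) mulr0.
by rewrite [delta_mx _ _ _ _]mxE !eqxx mulr1 mulrC.
Qed.

Definition hess (N : nat) (p : {mpoly F[N]}) : 'M[{mpoly F[N]}]_N :=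
  \matrix_(u, v) p^`M(u)^`M(v).

Lemma det_poly_eval (A : 'M[F]_n) :
  D.@[fun u => A (mxvec_unindex u).1 (mxvec_unindex u).2] = \det A.
Proof.
rewrite /det_poly -det_map_mx; congr (\det _); apply/matrixP=> i j.
by rewrite !mxE /= mevalXU mxvec_indexK.
Qed.

Lemma det_poly_neq0 : D != 0.
Proof.
apply/eqP=> D0; have := det_poly_eval 1%:M.
by rewrite D0 meval0 det1 => /esym/eqP; rewrite oner_eq0.
Qed.

Lemma hess_codet_hess : hess D *m codet_hess GX = (D *+ n.-1)%:M.
Proof.
apply/matrixP=> u w; case/mxvec_indexP: u => i j; case/mxvec_indexP: w => p q.
apply: (mulfI det_poly_neq0).
rewrite [in RHS]mxE eq_mxvec_index mxE sum_mxvec exchange_big mulr_sumr /=.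
have adjX (a b : 'I_n) : \sum_k \adj GX a k * GX k b = D *+ (a == b).
  by have /matrixP/(_ a b) := mul_adj_mx GX; rewrite !mxE.
have Xadj (a b : 'I_n) : \sum_k GX a k * \adj GX k b = D *+ (a == b).
  by have /matrixP/(_ a b) := mul_mx_adj GX; rewrite !mxE.
transitivity (\sum_l (\adj GX j i * GX p q * (D *+ (l == l))
   - \adj GX j i * GX p l * (D *+ (l == q)) *+ n.-1
   - GX p q * \adj GX l i * (D *+ (j == l))
   + GX p l * \adj GX l i * (D *+ (j == q)) *+ n.-1)).
  apply: eq_bigr => l _; rewrite -!adjX.
  rewrite !mulr_sumr -!sumrMnl -!sumrB -big_split /=. apply: eq_bigr => k _.
  rewrite [LHS]mulrA.
  rewrite [hess _ _ _]mxE det_poly_hess [codet_hess _ _ _]mxE !mxvec_indexK.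
  exact: hess_codet_term.
under eq_bigr do rewrite eqxx.
rewrite big_split /= !sumrB sumr_const card_ord.
have sum_lq : \sum_(l < n) (\adj GX j i * GX p l * (D *+ (l == q))) *+ n.-1
    = (\adj GX j i * GX p q * D) *+ n.-1.
  rewrite (bigD1 q) //= eqxx big1 ?addr0 // => l /negbTE ->.
  by rewrite mulr0 mul0rn.
have sum_jl : \sum_(l < n) GX p q * \adj GX l i * (D *+ (j == l))
    = \adj GX j i * GX p q * D.
  rewrite (bigD1 j) //= eqxx big1 ?addr0 => [|l ne]; last first.
    by rewrite eq_sym (negbTE ne) mulr0.
  by rewrite [GX p q * _]mulrC.
have sum_jq : \sum_(l < n) GX p l * \adj GX l i * (D *+ (j == q)) *+ n.-1
    = D *+ (p == i) * (D *+ (j == q)) *+ n.-1.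
  by rewrite sumrMnl -mulr_suml Xadj.
rewrite sum_lq sum_jl sum_jq.
(* The first three sums cancel because n - (n - 1) - 1 = 0; this fixes the coefficient [n.-1] in
   [codet_hess]. *)
have -> : \adj GX j i * GX p q * (D *+ true) *+ n =
    \adj GX j i * GX p q * D *+ n.-1 + \adj GX j i * GX p q * D.
  by rewrite -mulrSr prednK // (leq_ltn_trans _ (ltn_ord i)).
rewrite [X in X - _ - _]addrC addrK subrr add0r.
rewrite (eq_sym p); case: (i == p); case: (j == q);
  by rewrite /= ?mulr1n ?mulr0n ?mul0r ?mulr0 ?mul0rn // ?mulr0 // mulrnAr.
Qed.

(** At the identity matrix, where the determinant is 1, [hess_codet_hess] exhibits a power of [n.-1]
    as a multiple of this determinant. *)
Lemma det_codet_hess1_neq0 : n.-1%:R != 0 :> F -> \det (codet_hess (1%:M : 'M[F]_n)) != 0.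
Proof.
move=> n1_neq0.
pose ev := @meval (n * n) F (fun u => (1%:M : 'M[F]_n) (mxvec_unindex u).1 (mxvec_unindex u).2).
have evGX : map_mx ev GX = 1%:M.
  by apply/matrixP=> i j; rewrite mxE [GX _ _]mxE /ev mevalXU mxvec_indexK.
have := congr1 (fun A => \det (map_mx ev A)) hess_codet_hess.
rewrite map_mxM -map_codet_hess evGX map_scalar_mx det_mulmx det_scalar => eq_det.
apply: contraTneq n1_neq0 => G0; move: eq_det; rewrite G0 mulr0.
rewrite rmorphMn /= /ev det_poly_eval det1 => /esym/eqP.
by rewrite expf_eq0 => /andP[_ /eqP ->]; rewrite eqxx.
Qed.

(* With D = det and G the (scaled) inverse of the Hessian H, the Schur
   complement expresses det(W H W^T) det G as D^k times a polynomial, while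
   det G is a constant times D^(2n): the excess k - 2n is the multiplicity with
   which D divides det(W H W^T). *)
Lemma det_poly_dvd_hess (k : nat) (W : 'M[F]_(k, n * n)) :
  n.-1%:R != 0 :> F -> (n.*2 < k)%N ->
  exists Q, \det (map_mx (@mpolyC _ F) W *m hess D *m (map_mx (@mpolyC _ F) W)^T) = D * Q.
Proof.
move=> n1_neq0 lt_2n_k; set Wp := map_mx _ W; set M := \det _.
pose G := codet_hess GX; pose s := \det (codet_hess (1%:M : 'M[F]_n)).
have detG : \det G = D ^+ n.*2 * s%:MP.
  by rewrite /G det_codet_hess -(map_mx1 (@mpolyC (n * n) F)) map_codet_hess det_map_mx.
pose b := \det (block_mx G Wp^T (- Wp) 0).
(* Multiply on the left by the block matrix with rows [1, 0] and [Wp *m hess D, (D *+ n.-1)%:M]: as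
   [hess D *m G] is scalar, the lower left corner vanishes and no inverse of [G] is needed. *)
have eq_block : (D *+ n.-1) ^+ k * b = \det G * M.
  rewrite /b -(mul1r (_ ^+ k)) -(det1 {mpoly F[n * n]} (n * n)) -det_scalar.
  rewrite -(det_lblock _ (Wp *m hess D)) -det_mulmx mulmx_block.
  rewrite !mul1mx !mul0mx !mulmx0 !addr0 -mulmxA hess_codet_hess.
  by rewrite mul_mx_scalar mul_scalar_mx scalerN subrr det_ublock.
have s_neq0 : s != 0 by exact: det_codet_hess1_neq0.
have [e def_k] : exists e, k = (n.*2 + e.+1)%N.
  by exists (k - n.*2.+1)%N; rewrite addnS -addSn subnKC.
exists (s^-1%:MP * (n.-1%:R ^+ k * b * D ^+ e)).
apply: (@mulfI _ (D ^+ n.*2 * s%:MP)).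
  by rewrite mulf_neq0 ?expf_neq0 ?det_poly_neq0 // mpolyC_eq0.
have ss : s%:MP * s^-1%:MP = 1 :> {mpoly F[n * n]} by rewrite -mpolyCM mulfV.
rewrite -detG -eq_block detG -[D *+ n.-1]mulr_natr exprMn -[LHS]mul1r -{1}ss {1}def_k exprD exprS.
have reorder (R : comPzRingType) (s0 t d2 d de c b0 : R) :
  s0 * t * (d2 * (d * de) * c * b0) = d2 * s0 * (d * (t * (c * b0 * de))) by ring.
exact: reorder.
Qed.

End DetPolyHessian.

(** * Hessians under linear substitutions *)

Section Hessian.
Variable F : fieldType.

Definition dder (N : nat) (u : 'rV[F]_N) (p : {mpoly F[N]}) : {mpoly F[N]} :=
  \sum_i u 0 i *: p^`M(i).

Lemma dder_is_linear N (u : 'rV[F]_N) : linear (dder u).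
Proof.
move=> c p q; rewrite /dder scaler_sumr -big_split /=; apply: eq_bigr => i _.
by rewrite linearP scalerDr !scalerA [c * _]mulrC.
Qed.

HB.instance Definition _ N (u : 'rV[F]_N) :=
  GRing.isLinear.Build F {mpoly F[N]} {mpoly F[N]} *:%R (dder u) (dder_is_linear u).

Lemma dderM N (u : 'rV[F]_N) p q : dder u (p * q) = dder u p * q + p * dder u q.
Proof.
rewrite /dder mulr_suml mulr_sumr -big_split /=; apply: eq_bigr => i _.
by rewrite mderivM scalerDr scalerAl scalerAr.
Qed.

(** Arbitrary directions replace coordinate minors because this family is stable under linear
    substitution, which turns [W] into [W *m A^T]. *)
Definition hess_on (k N : nat) (W : 'M[F]_(k, N)) (p : {mpoly F[N]}) :
    'M[{mpoly F[N]}]_k :=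
  \matrix_(a, b) dder (row b W) (dder (row a W) p).

Lemma hess_onE (k N : nat) (W : 'M[F]_(k, N)) (p : {mpoly F[N]}) :
  hess_on W p =
    map_mx (@mpolyC N F) W *m hess p *m (map_mx (@mpolyC N F) W)^T.
Proof.
apply/matrixP=> a b; rewrite !mxE /dder; apply: eq_bigr => j _.
rewrite !mxE (raddf_sum (mderiv j)) scaler_sumr mulr_suml; apply: eq_bigr => i _.
by rewrite !mxE /= mderivZ -!mul_mpolyC mulrC.
Qed.

Lemma det_hess_onZ (k N : nat) (W : 'M[F]_(k, N)) c (p : {mpoly F[N]}) :
  \det (hess_on W (c *: p)) = c ^+ k *: \det (hess_on W p).
Proof.
rewrite -[RHS]mul_mpolyC rmorphXn /= -detZ; congr (\det _).
by apply/matrixP=> a b; rewrite !mxE !linearZ /= mul_mpolyC.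
Qed.

HB.instance Definition _ (M N : nat) (A : 'M[F]_(M, N)) :=
  GRing.LRMorphism.copy (linear_subst A)
    (comp_mpoly [tuple linear_form (row i A) | i < M]).

Lemma linear_substX (M N : nat) (A : 'M[F]_(M, N)) i :
  linear_subst A 'X_i = linear_form (row i A).
Proof. by rewrite /linear_subst comp_mpolyXU -tnth_nth tnth_mktuple. Qed.

Lemma dder_linear_form N (u a : 'rV[F]_N) :
  dder u (linear_form a) = ((u *m a^T) 0 0)%:MP.
Proof.
rewrite /linear_form linear_sum /= mxE rmorph_sum; apply: eq_bigr => i _.
rewrite linearZ /= /dder (bigD1 i) //= big1 => [|j ne_ji].
  by rewrite addr0 mderiv_mpolyXU eqxx scalerA -mul_mpolyC mulr1 mulrC mxE.
by rewrite mderiv_mpolyXU eq_sym (negbTE ne_ji) scaler0.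
Qed.

Lemma dder_linear_subst (M N : nat) (A : 'M[F]_(M, N)) u p :
  dder u (linear_subst A p) = linear_subst A (dder (u *m A^T) p).
Proof.
elim/mpoly_alg_ind: p => [|i|c p IH|p q IHp IHq|p q IHp IHq].
- rewrite rmorph1 /dder !big1 ?rmorph0 // => i _;
  by rewrite -mpolyC1 mderivC scaler0.
- rewrite linear_substX dder_linear_form /dder (bigD1 i) //= big1 => [|j ne_ji].
    rewrite addr0 mderiv_mpolyXU eqxx linearZ /= rmorph1 -mul_mpolyC mulr1.
    by congr _%:MP; rewrite !mxE; apply: eq_bigr => j _; rewrite !mxE.
  by rewrite mderiv_mpolyXU eq_sym (negbTE ne_ji) scaler0.
- by rewrite !linearZ /= IH.
- by rewrite !linearD /= IHp IHq.
by rewrite rmorphM !dderM IHp IHq rmorphD !rmorphM.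
Qed.

Lemma hess_on_linear_subst (k M N : nat) (A : 'M[F]_(M, N)) (W : 'M[F]_(k, N)) p :
  hess_on W (linear_subst A p) = map_mx (linear_subst A) (hess_on (W *m A^T) p).
Proof. by apply/matrixP=> a b; rewrite !mxE !dder_linear_subst !row_mul. Qed.

Lemma linear_form_eval N (a : 'rV[F]_N) (x : 'cV[F]_N) :
  (linear_form a).@[fun i => x i 0] = (a *m x) 0 0.
Proof.
rewrite /linear_form raddf_sum mxE; apply: eq_bigr => i _.
by rewrite /= mevalZ mevalXU.
Qed.

Lemma linear_subst_eval (M N : nat) (A : 'M[F]_(M, N)) p (x : 'cV[F]_N) :
  (linear_subst A p).@[fun i => x i 0] = p.@[fun i => (A *m x) i 0].
Proof.
rewrite /linear_subst comp_mpoly_meval; apply: meval_eq => i.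
by rewrite tnth_mktuple linear_form_eval -row_mul mxE.
Qed.

Lemma linear_form_homog N (a : 'rV[F]_N) : linear_form a \is 1.-homog.
Proof.
by apply: rpred_sum => i _; apply: rpredZ; rewrite dhomogX /= mdeg1.
Qed.

Lemma dhomog_bigprod (N : nat) (I : Type) (r : seq I) (p : I -> {mpoly F[N]}) (e : I -> nat) :
  (forall i, p i \is (e i).-homog) ->
  \prod_(i <- r) p i \is (\sum_(i <- r) e i).-homog.
Proof.
move=> hp; elim: r => [|i r IHr]; first by rewrite !big_nil dhomog1.
by rewrite !big_cons; apply: dhomogM.
Qed.

Lemma linear_subst_homog (M N : nat) (A : 'M[F]_(M, N)) d p :
  p \is d.-homog -> linear_subst A p \is d.-homog.
Proof.
move=> /dhomogP hp; rewrite (mpolyE p) linear_sum big_seq; apply: rpred_sum => m /hp <-.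
rewrite linearZ; apply: rpredZ; rewrite /= /linear_subst comp_mpolyX mdegE.
apply: dhomog_bigprod => i; rewrite tnth_mktuple -[X in X.-homog]mul1n.
exact/dhomogMn/linear_form_homog.
Qed.

Lemma det_poly_homog n : det_poly F n \is n.-homog.
Proof.
apply: rpred_sum => s _; rewrite -signr_odd mulr_sign.
have hp : \prod_i generic_mx F n i (s i) \is n.-homog.
  have := @dhomog_bigprod _ _ (index_enum 'I_n) (fun i => generic_mx F n i (s i)) (fun=> 1%N).
  rewrite sum1_card card_ord; apply=> i.
  by rewrite mxE dhomogX /= mdeg1.
by case: (odd _); rewrite ?rpredN.
Qed.

Lemma det_orbit_proj_point n h :
  proj_orbit (det_poly F n) h -> proj_point n h.
Proof.
case=> g [c] [g_unit c_neq0 ->]; split; last first.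
  exact/rpredZ/linear_subst_homog/det_poly_homog.
rewrite scaler_eq0 (negbTE c_neq0) /=; apply/eqP=> h0.
(* The substituted determinant takes the value 1 at the preimage of the identity matrix under
   [g]. *)
pose v : 'cV[F]_(n * n) := \col_u (1%:M : 'M[F]_n) (mxvec_unindex u).1 (mxvec_unindex u).2.
have := linear_subst_eval g (det_poly F n) (invmx g *m v).
rewrite h0 meval0 mulKVmx // (meval_eq _ (v2 := fun u => (1%:M : 'M[F]_n) (mxvec_unindex u).1 (mxvec_unindex u).2)).
  by rewrite det_poly_eval det1 => /esym/eqP; rewrite oner_eq0.
by move=> u; rewrite mxE.
Qed.

Lemma det_orbit_dvd_hess n k (W : 'M[F]_(k, n * n)) h :
  n.-1%:R != 0 :> F -> (n.*2 < k)%N -> proj_orbit (det_poly F n) h ->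
  exists Q, \det (hess_on W h) = h * Q.
Proof.
move=> n1_neq0 lt_2n_k [g [c] [_ c_neq0 ->]].
have [Q defQ] := det_poly_dvd_hess (W *m g^T) n1_neq0 lt_2n_k.
exists ((c ^+ k / c) *: linear_subst g Q).
rewrite det_hess_onZ hess_on_linear_subst det_map_mx hess_onE defQ rmorphM /=.
by rewrite -scalerAl -scalerAr scalerA mulrCA mulfV // mulr1.
Qed.

End Hessian.

(** * Divisibility passes to the closure *)

Section PseudoRemainder.

(* A pseudo-division of q by p that treats d as the degree of p even when
   p`_d = 0, so that it commutes with every ring morphism. *)
Fixpoint formal_prem (R : comNzRingType) (d : nat) (p : {poly R}) (K : nat)
    (q : {poly R}) : {poly R} :=
  if K is K'.+1 then
    formal_prem d p K' (p`_d *: q - q`_(d + K') *: ('X^K' * p))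
  else q.

Lemma map_formal_prem (R S : comNzRingType) (f : {rmorphism R -> S}) d p K q :
  map_poly f (formal_prem d p K q) = formal_prem d (map_poly f p) K (map_poly f q).
Proof.
elim: K q => [|K IHK] q //=; rewrite IHK rmorphB /= !linearZ /=.
by rewrite rmorphM /= map_polyXn !coef_map.
Qed.

Lemma size_formal_prem (R : comNzRingType) d (p : {poly R}) K (q : {poly R}) :
  (size p <= d.+1)%N -> (size q <= d + K)%N -> (size (formal_prem d p K q) <= d)%N.
Proof.
move=> sz_p; elim: K q => [|K IHK] q sz_q /=; first by rewrite addn0 in sz_q.
apply: IHK; apply/leq_sizeP=> j; rewrite leq_eqVlt => /orP[/eqP <-|lt_j].
  (* In degree d + K the two terms have the same coefficient, so each step lowers the size bound by
     one. *)
  by rewrite coefB !coefZ coefXnM ltnNge leq_addl /= addnK mulrC subrr.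
rewrite coefB !coefZ coefXnM.
have /leq_sizeP/(_ j) -> := sz_q; last by rewrite addnS.
have /leq_sizeP/(_ (j - K)%N) -> := sz_p; last by rewrite ltn_subRL addnC.
by rewrite if_same !mulr0 subrr.
Qed.

Lemma formal_premE (R : comNzRingType) d (p : {poly R}) K (q : {poly R}) :
  exists Q, formal_prem d p K q = p`_d ^+ K *: q - Q * p.
Proof.
elim: K q => [|K IHK] q /=; first by exists 0; rewrite scale1r mul0r subr0.
have [Q ->] := IHK (p`_d *: q - q`_(d + K) *: ('X^K * p)).
exists (Q + p`_d ^+ K *: (q`_(d + K) *: 'X^K)).
by rewrite exprSr -scalerA scalerBr mulrDl -!scalerAl opprD addrA addrAC.
Qed.

(** The formal remainder is a multiple of [p] of size at most d, while the nonzero coefficient of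
    degree d gives [p] a larger size. *)
Lemma formal_prem_dvd (F : fieldType) d (p q : {poly F}) K :
  (size p <= d.+1)%N -> (size q <= d + K)%N -> p`_d != 0 -> p %| q ->
  formal_prem d p K q = 0.
Proof.
move=> sz_p sz_q pd_neq0 p_dvd_q; have [Q defr] := formal_premE d p K q.
have sz_r := size_formal_prem sz_p sz_q.
have : p %| formal_prem d p K q.
  by rewrite defr dvdp_subl ?dvdpZr ?expf_neq0 // dvdp_mull.
apply: contraTeq => r_neq0; apply/negP => /(dvdp_leq r_neq0).
rewrite leqNgt (leq_ltn_trans sz_r) // ltnNge; apply/negP => /leq_sizeP/(_ d).
by rewrite leqnn => /(_ isT) pd0; rewrite pd0 eqxx in pd_neq0.
Qed.

End PseudoRemainder.

Lemma coefM_top (R : nzRingType) a b (p q : {poly R}) :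
  (size p <= a.+1)%N -> (size q <= b.+1)%N ->
  (size (p * q)%R <= (a + b).+1)%N /\ (p * q)`_(a + b) = p`_a * q`_b.
Proof.
move=> sz_p sz_q; split.
  by have := size_polyMleq p q; lia.
have lt_a : (a < (a + b).+1)%N by rewrite ltnS leq_addr.
rewrite coefM (bigD1 (Ordinal lt_a)) //= addKn big1 ?addr0 // => j ne_ja.
have /leq_sizeP p0 := sz_p; have /leq_sizeP q0 := sz_q.
have [lt_ja|lt_aj|eq_ja] := ltngtP j a.
- by rewrite [X in _ * X]q0 ?mulr0 //; lia.
- by rewrite p0 ?mul0r.
by case/eqP: ne_ja; apply: val_inj.
Qed.

(** * Equations in the coefficients of a form, and restriction to a line *)

Section ClosureHess.
Variables (F : fieldType) (N d : nat).
Local Notation K := #|{: 'X_{1..N < d.+1}}|.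

(** [coef_eval] with its arguments swapped, so that it is a ring morphism that can be mapped over
    polynomials in the line parameter. *)
Definition coef_morph (f : {mpoly F[N]}) : {mpoly F[K]} -> F :=
  meval (fun k => f@_(enum_val k : 'X_{1..N < d.+1})).

HB.instance Definition _ f := GRing.RMorphism.copy (coef_morph f)
  (meval (fun k : 'I_K => f@_(enum_val k : 'X_{1..N < d.+1}))).

(** The points of P(S^d) where all homogeneous equations of [Y] hold form a closed set containing
    [Y], hence containing its closure. *)
Lemma closure_coef_morph (Y : {mpoly F[N]} -> Prop) f :
  (forall h, Y h -> proj_point d h) -> zariski_closure d Y f ->
  proj_point d f /\
  forall e (P : {mpoly F[K]}), P \is e.-homog ->
    (forall h, Y h -> coef_morph h P = 0) -> coef_morph f P = 0.
Proof.
move=> Yp clYf.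
pose E (P : {mpoly F[K]}) := (exists e, P \is e.-homog) /\
  forall h, Y h -> coef_morph h P = 0.
have [||fp fE] := clYf (fun h => proj_point d h /\ forall P, E P -> coef_eval P h = 0).
- by exists E; split=> // P [].
- by move=> h Yh; split=> [|P [_ /(_ h Yh)]] //; apply: Yp.
by split=> // e P hP YP; apply: fE; split=> //; exists e.
Qed.

Definition coef_homog (e : nat) (p : {poly {mpoly F[K]}}) :=
  forall i, p`_i \is e.-homog.

Lemma coef_homogM e1 e2 p q :
  coef_homog e1 p -> coef_homog e2 q -> coef_homog (e1 + e2) (p * q).
Proof.
by move=> hp hq i; rewrite coefM; apply: rpred_sum => j _; apply: dhomogM.
Qed.

Lemma coef_homog_prod (I : Type) (r : seq I) (p : I -> {poly {mpoly F[K]}}) :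
  (forall i, coef_homog 1 (p i)) -> coef_homog (size r) (\prod_(i <- r) p i).
Proof.
move=> hp; elim: r => [|i r IHr].
  by rewrite big_nil => i; rewrite coef1; case: (i == 0)%N; rewrite ?dhomog1 ?rpred0.
by rewrite big_cons; apply: (@coef_homogM 1).
Qed.

Lemma coef_homog_det k (A : 'M[{poly {mpoly F[K]}}]_k) :
  (forall i j, coef_homog 1 (A i j)) -> coef_homog k (\det A).
Proof.
move=> hA i; rewrite coef_sum; apply: rpred_sum => s _.
have := @coef_homog_prod _ (index_enum 'I_k) (fun i => A i (s i)) (fun i => hA i _) i.
rewrite -[index_enum _]enumT size_enum_ord -signr_odd mulr_sign.
by case: (odd _) => //; rewrite coefN rpredN.
Qed.

Lemma coef_homog_formal_prem e1 e2 p L q :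
  coef_homog e1 p -> coef_homog e2 q ->
  coef_homog (e1 * L + e2) (formal_prem d p L q).
Proof.
move=> hp; elim: L e2 q => [|L IHL] e2 q hq /=; first by rewrite muln0.
rewrite mulnS -addnA addnCA; apply: IHL => i; rewrite coefB !coefZ coefXnM.
apply: rpredB; first exact: dhomogM.
by rewrite [(e1 + e2)%N]addnC; apply: dhomogM => //; case: ifP => _; rewrite ?rpred0.
Qed.

(** The image under [L] of the generic polynomial, whose coefficients are the variables;
    [coef_morph f] specializes it to [L f]. *)
Definition coef_linear (L : {mpoly F[N]} -> {poly F}) : {poly {mpoly F[K]}} :=
  \sum_(k < K) 'X_k *: map_poly (@mpolyC K F) (L 'X_[enum_val k : 'X_{1..N < d.+1}]).

Lemma coef_linear_homog L : coef_homog 1 (coef_linear L).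
Proof.
move=> i; rewrite coef_sum; apply: rpred_sum => k _.
rewrite coefZ coef_map /= mulrC mul_mpolyC; apply: rpredZ.
by rewrite dhomogX /= mdeg1.
Qed.

Lemma coef_linearE (L : {linear {mpoly F[N]} -> {poly F}}) f :
  f \is d.-homog -> map_poly (coef_morph f) (coef_linear L) = L f.
Proof.
move=> hf; have sz_f : (msize f <= d.+1)%N.
  rewrite msizeE; apply/bigmax_leqP_seq => m m_f _.
  by rewrite (dhomog_mf hf m_f).
rewrite [in RHS](mpolywE sz_f) !linear_sum [RHS](reindex (fun k : 'I_K => enum_val k)); last first.
  exact/onW_bij/enum_val_bij.
apply: eq_bigr => k _; rewrite !linearZ /=; congr (_ *: _).
  by rewrite /coef_morph mevalXU.
rewrite -map_poly_comp_id0 ?map_poly_id ?rmorph0 //.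
by move=> a _; rewrite /= /coef_morph mevalC.
Qed.

Definition on_line (x y : 'I_N -> F) : {mpoly F[N]} -> {poly F} :=
  mmap (@polyC F) (fun i => (x i)%:P + (y i) *: 'X).

HB.instance Definition _ x y := GRing.RMorphism.copy (on_line x y)
  (mmap (@polyC F) (fun i => (x i)%:P + (y i) *: 'X)).

Lemma on_line_is_scalable x y : scalable (on_line x y).
Proof. by move=> c p; rewrite /on_line mmapZ mul_polyC. Qed.

HB.instance Definition _ x y := GRing.isScalable.Build F {mpoly F[N]} {poly F} *:%R
  (on_line x y) (on_line_is_scalable x y).

Lemma on_line0 x y p : (on_line x y p).[0] = p.@[x].
Proof.
elim/mpoly_alg_ind: p => [|i|c p IH|p q IHp IHq|p q IHp IHq].
- by rewrite !rmorph1 hornerC.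
- by rewrite mevalXU /on_line mmapX mmap1U !hornerE.
- by rewrite !linearZ /= hornerZ IH.
- by rewrite !rmorphD hornerD IHp IHq.
by rewrite !rmorphM hornerM IHp IHq.
Qed.

(** Each of the d linear factors of a monomial becomes x_i + t y_i, so t^d arises only from the
    product of the y_i. Thus p(y) is the formal leading coefficient on the line. *)
Lemma on_line_top x y p :
  p \is d.-homog -> (size (on_line x y p) <= d.+1)%N /\ (on_line x y p)`_d = p.@[y].
Proof.
move=> hp.
have prodX (r : seq 'I_N) (m : 'I_N -> nat) :
    let q := \prod_(i <- r) ((x i)%:P + (y i) *: 'X) ^+ m i in
    let e := (\sum_(i <- r) m i)%N in
    (size q <= e.+1)%N /\ q`_e = \prod_(i <- r) (y i) ^+ m i.
  elim: r => [|i r [IHs IHc]] /=.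
    by rewrite !big_nil size_poly1 coef1.
  rewrite !big_cons -IHc.
  have [sz_i <-] : (size (((x i)%:P + y i *: 'X) ^+ m i)%R <= (m i).+1)%N /\
      (((x i)%:P + y i *: 'X) ^+ m i)`_(m i) = y i ^+ m i.
    elim: (m i) => [|e [IHes IHec]]; first by rewrite expr0 size_poly1 coef1.
    have sz1 : (size ((x i)%:P + y i *: 'X)%R <= 2)%N.
      rewrite (leq_trans (size_polyD _ _)) // geq_max.
      by rewrite (leq_trans (size_polyC_leq1 _)) // (leq_trans (size_scale_leq _ _)) ?size_polyX.
    have [sz_e ce] := coefM_top sz1 IHes.
    by rewrite !exprS -IHec; split=> //; rewrite ce coefD coefC coefZ coefX add0r mulr1.
  exact: coefM_top.
rewrite (mpolyE p) !linear_sum /= coef_sum; split.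
  apply: (leq_trans (size_sum _ _ _)); apply/bigmax_leqP_seq => m m_p _.
  rewrite linearZ /=; apply: (leq_trans (size_scale_leq _ _)).
  rewrite /on_line mmapX -(dhomog_mf hp m_p) /= mdegE.
  by have [] := prodX (index_enum 'I_N) m.
rewrite big_seq [RHS]big_seq; apply: eq_bigr => m m_p.
rewrite linearZ /= coefZ mevalZ mevalX; congr (_ * _).
rewrite /on_line mmapX -(dhomog_mf hp m_p) /= mdegE.
by have [] := prodX (index_enum 'I_N) m.
Qed.

Lemma closure_dvd_hess (k : nat) (W : 'M[F]_(k, N)) (Y : {mpoly F[N]} -> Prop) f x y :
  (forall h, Y h -> proj_point d h) ->
  (forall h, Y h -> exists Q, \det (hess_on W h) = h * Q) ->
  zariski_closure d Y f -> f.@[x] = 0 -> f.@[y] != 0 ->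
  (\det (hess_on W f)).@[x] = 0.
Proof.
move=> Yp Ydvd clYf fx0 fy_neq0; have [[_ hf] fP] := closure_coef_morph Yp clYf.
pose p := coef_linear (on_line x y).
pose H a b := coef_linear (on_line x y \o dder (row b W) \o dder (row a W)).
pose q := \det (\matrix_(a, b) H a b).
have pE h : h \is d.-homog -> map_poly (coef_morph h) p = on_line x y h.
  by move=> hh; rewrite /p coef_linearE.
have qE h : h \is d.-homog ->
    map_poly (coef_morph h) q = on_line x y (\det (hess_on W h)).
  move=> hh; rewrite /q -!det_map_mx; congr (\det _); apply/matrixP=> a b.
  rewrite !mxE.
  exact: (coef_linearE (on_line x y \o dder (row b W) \o dder (row a W)) hh).
(* The size of the generic [q] bounds that of all its specializations, so one number of division
   steps serves every form. *)
pose r := formal_prem d p (size q) q.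
have rE h : h \is d.-homog -> map_poly (coef_morph h) r =
    formal_prem d (on_line x y h) (size q) (on_line x y (\det (hess_on W h))).
  by move=> hh; rewrite map_formal_prem pE // qE.
have sz_q h : h \is d.-homog ->
    (size (on_line x y (\det (hess_on W h))) <= d + size q)%N.
  move=> hh; rewrite -qE //; apply: leq_trans (leq_addl _ _).
  exact: size_poly.
(* The scalar is h(y). If it is nonzero, d is the true degree of h on the line and divisibility
   makes the remainder vanish. *)
have r0 h : Y h -> (on_line x y h)`_d *: map_poly (coef_morph h) r = 0.
  move=> Yh; have [_ hh] := Yp h Yh; have [sz_h _] := on_line_top x y hh.
  have [->|hd_neq0] := eqVneq (on_line x y h)`_d 0; first by rewrite scale0r.
  have [Q defQ] := Ydvd h Yh.
  rewrite rE // formal_prem_dvd ?scaler0 ?sz_q //.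
  by rewrite defQ rmorphM dvdp_mulr.
have fr0 : map_poly (coef_morph f) r = 0.
  apply/polyP=> i; rewrite coef0 coef_map /=.
  have hpr : p`_d * r`_i \is (1 + (1 * size q + k)).-homog.
    apply: dhomogM; first exact: coef_linear_homog.
    apply: coef_homog_formal_prem; first exact: coef_linear_homog.
    by apply: coef_homog_det => a b; rewrite mxE; apply: coef_linear_homog.
  have /eqP : coef_morph f (p`_d * r`_i) = 0.
    apply: (fP _ _ hpr) => h Yh; have [_ hh] := Yp h Yh.
    have /polyP/(_ i) := r0 h Yh; rewrite coef0 coefZ coef_map /= => <-.
    by rewrite rmorphM /= -pE // coef_map.
  rewrite rmorphM mulf_eq0 /= -[coef_morph f p`_d]coef_map /= pE //.
  by have [_ ->] := on_line_top x y hf; rewrite (negbTE fy_neq0) => /eqP.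
(* A power of f(y) times the Hessian determinant is now a multiple of f on the line; parameter 0
   gives the point x, where f vanishes. *)
have [Q defr] := formal_premE d (on_line x y f) (size q) (on_line x y (\det (hess_on W f))).
move: defr; rewrite -rE // fr0 => /(congr1 (fun s => s.[0])).
have [_ ->] := on_line_top x y hf.
rewrite horner0 hornerD hornerN hornerM hornerZ !on_line0 fx0 mulr0 subr0.
by move/esym/eqP; rewrite mulf_eq0 expf_eq0 (negbTE fy_neq0) andbF => /eqP.
Qed.

End ClosureHess.

(** * The Hessian of the permanent *)

(** Right multiplication by [s0^-1] maps these permutations onto those supported in the complement
    of [A]. *)
Lemma card_perm_agree (T : finType) (A : {set T}) (s0 : {perm T}) :
  #|[set s : {perm T} | [forall x in A, s x == s0 x]]| = #|~: A|`!.
Proof.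
rewrite -card_perm -(card_imset _ (@mulIg {perm T} (s0^-1)%g)).
apply: eq_card => t; apply/imsetP/idP => [[s]|t_on].
  rewrite inE => /forall_inP s_eq ->; apply/subsetP => x.
  rewrite !inE; apply: contraNN => Ax.
  by rewrite permM (eqP (s_eq x Ax)) permK.
exists (t * s0)%g; last by rewrite mulgK.
rewrite inE; apply/forall_inP => x Ax; rewrite permM.
by rewrite (out_perm t_on) // inE Ax.
Qed.

Section PermanentHessian.
Variables (F : numFieldType) (p : nat).
Local Notation m := p.+3.

Definition perm_mon (s : 'S_m) : 'X_{1..m * m} :=
  (\sum_i U_(mxvec_index i (s i)))%MM.

Lemma perm_monE s i j : perm_mon s (mxvec_index i j) = (s i == j).
Proof.
rewrite mnm_sumE (bigD1 i) //= big1 => [|k ne_ki].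
  by rewrite mnm1E eq_mxvec_index eqxx addn0.
by rewrite mnm1E eq_mxvec_index (negbTE ne_ki).
Qed.

Lemma perm_polyE : perm_poly F m = \sum_s 'X_[perm_mon s].
Proof.
apply: eq_bigr => s _; rewrite /perm_mon (big_morph (fun mon => (mpolyX F mon)) (@mpolyXD _ _) (@mpolyX0 _ _)).
by apply: eq_bigr => i _; rewrite mxE.
Qed.

(* The zero of the permanent used by Mignon and Ressayre. *)
Definition mr_point : 'cV[F]_(m * m) :=
  \col_u (if u == mxvec_index 0 0 then 1 - m%:R else 1).

Lemma mr_point_mon (mon : 'X_{1..m * m}) :
  'X_[mon].@[fun u => mr_point u 0] = (1 - m%:R) ^+ mon (mxvec_index 0 0).
Proof.
rewrite mevalX (bigD1 (mxvec_index 0 0)) //= mxE eqxx big1 ?mulr1 // => u ne_u.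
by rewrite mxE (negbTE ne_u) expr1n.
Qed.

Lemma sum_perm_agree (A : {set 'I_m}) (s0 : 'S_m) :
  \sum_(s : 'S_m | [forall x in A, s x == s0 x]) 1 = (#|~: A|`!)%:R :> F.
Proof.
rewrite -(card_perm_agree A s0) sumr_const; congr (_ *+ _).
by apply: eq_card => s; rewrite inE.
Qed.

(** The value is m! - m (m - 1)!, since (1 - m)^e = 1 - m e for e = 0 or 1 and (m - 1)! permutations
    fix 0. *)
Lemma perm_poly_mr_point : (perm_poly F m).@[fun u => mr_point u 0] = 0.
Proof.
rewrite perm_polyE raddf_sum /=.
under eq_bigr do rewrite mr_point_mon perm_monE.
transitivity (\sum_(s : 'S_m) (1 : F) - m%:R * \sum_(s : 'S_m | [forall x in [set (0 : 'I_m)], s x == (1%g : 'S_m) x]) 1).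
  rewrite mulr_sumr [X in _ = _ - X]big_mkcond -sumrB; apply: eq_bigr => s _.
  have -> : [forall x in [set 0], s x == (1%g : 'S_m) x] = (s 0 == 0).
    apply/forall_inP/idP => [s_eq|/eqP s0 x]; last first.
      by rewrite inE perm1 => /eqP ->; rewrite s0.
    by have := s_eq 0; rewrite inE eqxx perm1 => ->.
  by case: (s 0 == 0); rewrite ?mulr1 ?subr0.
rewrite sum_perm_agree sumr_const card_Sn cardsC1 card_ord -natrM.
by rewrite factS subrr.
Qed.

Lemma perm_poly_ones : (perm_poly F m).@[fun=> 1] = (m`!)%:R.
Proof.
rewrite perm_polyE raddf_sum /= -[in RHS]card_Sn -sumr_const.
by apply: eq_bigr => s _; rewrite mevalX big1 // => i _; rewrite expr1n.
Qed.

(* The second derivatives of the permanent at mr_point, divided by (m - 3)!: they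
   are permanents of size m - 2, equal to (m - 2)! when the special entry is
   deleted and to (m - 2)! - m (m - 3)! = - 2 (m - 3)! otherwise. *)
Definition mr_weight (i j k l : 'I_m) : F :=
  if (i == k) || (j == l) then 0
  else if [|| i == 0, j == 0, k == 0 | l == 0] then p.+1%:R else - 2%:R.

Lemma perm_poly_mr_hess (i j k l : 'I_m) :
  ((perm_poly F m)^`M(mxvec_index i j)^`M(mxvec_index k l)).@[fun u => mr_point u 0]
  = (p`!)%:R * mr_weight i j k l.
Proof.
(* The exponent of 1 - m is 1 exactly when [s] fixes 0 and the entry (0, 0) has not been
   differentiated away. *)
have coefE (s : 'S_m) :
    ('X_[perm_mon s]^`M(mxvec_index i j)^`M(mxvec_index k l)).@[fun u => mr_point u 0]
    = if [&& i != k, s i == j & s k == l] then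
        (1 - m%:R) ^+ ((s 0 == 0) - ((i == 0) && (j == 0)) - ((k == 0) && (l == 0)))
      else 0 :> F.
  rewrite mderivX linearZ /= mderivX !mevalZ mr_point_mon !mnmBE !mnm1E !perm_monE.
  rewrite !eq_mxvec_index.
  have [<-|ne_ik] := eqVneq i k => /=.
    have [<-|] := eqVneq (s i) j; last by rewrite mul0r.
    by have [<-|] := eqVneq (s i) l; rewrite ?subnn ?sub0n mul0r ?mulr0.
  by case: (s i == j); case: (s k == l); rewrite ?mul0r ?mul1r ?mulr0 ?subn0 ?mul0r.
rewrite perm_polyE (raddf_sum (mderiv (mxvec_index i j))) /=.
rewrite (raddf_sum (mderiv (mxvec_index k l))) raddf_sum /=.
under eq_bigr do rewrite coefE.
rewrite -big_mkcond /= /mr_weight.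
have [eq_ik|ne_ik] := eqVneq i k; first by rewrite big_pred0 // mulr0.
have [eq_jl|ne_jl] /= := eqVneq j l.
  rewrite big_pred0 ?mulr0 // => s; apply/negbTE; apply: contra ne_ik => /andP[/eqP si /eqP sk].
  by rewrite -(inj_eq (@perm_inj _ s)) si sk eq_jl.
(* Some permutation sending i to j and k to l, needed to count such permutations by agreement with
   it. *)
pose s0 : 'S_m := (tperm i j * tperm (tperm i j k) l)%g.
have tk_j : tperm i j k != j.
  by rewrite -(inj_eq (@perm_inj _ (tperm i j))) tpermK tpermR eq_sym.
have s0i : s0 i = j by rewrite permM tpermL (tpermD tk_j) // eq_sym.
have s0k : s0 k = l by rewrite permM tpermL.
have agree2 (s : 'S_m) : [forall x in [set i; k], s x == s0 x] = (s i == j) && (s k == l).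
  apply/forall_inP/andP => [s_eq|[si sk] x].
    by rewrite -s0i -s0k !s_eq // !inE eqxx ?orbT.
  by rewrite !inE => /orP[] /eqP ->; rewrite ?s0i ?s0k.
have count2 : \sum_(s : 'S_m | (s i == j) && (s k == l)) 1 = (p.+1`!)%:R :> F.
  under eq_bigl do rewrite -agree2.
  rewrite sum_perm_agree; congr (_`!)%:R.
  by have := cardsC [set i; k]; rewrite cards2 ne_ik card_ord => /eqP; rewrite add2n !eqSS => /eqP.
have [h0|] := boolP [|| i == 0, j == 0, k == 0 | l == 0].
  transitivity (\sum_(s : 'S_m | (s i == j) && (s k == l)) (1 : F)); last first.
    by rewrite count2 factS mulnC natrM.
  apply: eq_bigr => s /andP[/eqP si /eqP sk].
  (* Row 0 or column 0 has been deleted, so the special entry no longer occurs. *)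
  rewrite (_ : _ - _ = 0)%N // -si -sk.
  have inj0 (x : 'I_m) : s x == 0 -> (s 0 == 0) = (x == 0).
    by move=> /eqP sx; rewrite -sx (inj_eq perm_inj) eq_sym.
  move: h0; rewrite -si -sk => /or4P[] /eqP e; rewrite ?e ?eqxx //=.
  - by case: (s 0 == 0).
  - have -> : (s 0 == 0) = (i == 0) by apply: inj0; rewrite e.
    by case: (i == 0).
  - by case: (s 0 == 0); case: ((i == 0) && _).
  have -> : (s 0 == 0) = (k == 0) by apply: inj0; rewrite e.
  by case: (k == 0); case: ((i == 0) && _).
rewrite !negb_or => /and4P[i0 j0 k0 l0].
have s00 : s0 0 = 0.
  have t0 : tperm i j 0 = 0 by rewrite tpermD.
  have tk_0 : tperm i j k != 0 by rewrite -(inj_eq (@perm_inj _ (tperm i j))) tpermK t0.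
  by rewrite permM t0 (tpermD tk_0).
have agree3 (s : 'S_m) : [forall x in [set 0; i; k], s x == s0 x] =
    [&& s i == j, s k == l & s 0 == 0].
  apply/forall_inP/and3P => [s_eq|[si sk s_0] x].
    by split; [rewrite -s0i | rewrite -s0k | rewrite -[X in _ == X]s00]; apply: s_eq;
      rewrite !inE eqxx ?orbT.
  by rewrite !inE => /orP[/orP[]|] /eqP ->; rewrite ?s0i ?s0k ?s00.
have count3 : \sum_(s : 'S_m | [&& s i == j, s k == l & s 0 == 0]) 1 = (p`!)%:R :> F.
  under eq_bigl do rewrite -agree3.
  rewrite sum_perm_agree; congr (_`!)%:R.
  have := cardsC [set 0; i; k]; rewrite card_ord -setUA cardsU1 cards2 ne_ik !inE negb_or.
  rewrite [0 == i]eq_sym [0 == k]eq_sym i0 k0 /= => /eqP.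
  by rewrite -addnA add1n add2n !eqSS => /eqP.
transitivity (\sum_(s : 'S_m | (s i == j) && (s k == l)) (1 : F)
    - m%:R * \sum_(s : 'S_m | [&& s i == j, s k == l & s 0 == 0]) 1).
  rewrite mulr_sumr; under [in X in _ = _ - X]eq_bigl do rewrite andbA.
  rewrite [X in _ = _ - X]big_mkcondr -sumrB; apply: eq_bigr => s _.
  rewrite (negbTE i0) (negbTE k0) !subn0.
  by case: (s 0 == 0); rewrite ?mulr1 ?subr0.
rewrite count2 count3 factS natrM -mulrBl mulrC; congr (_ * _).
by rewrite -[m]addn2 -[p.+1]addn0 natrD; ring.
Qed.

End PermanentHessian.

(** * Nondegeneracy of the Hessian of the permanent at the chosen zero *)

Section WeightKernel.
Variables (F : numFieldType) (p : nat).
Local Notation m := p.+3.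
Implicit Type V : 'I_m -> 'I_m -> F.

Let rows V i := \sum_l V i l.
Let cols V j := \sum_k V k j.
Let total V := \sum_i rows V i.
Let tr V i j := V j i.

Let total_tr V : total (tr V) = total V.
Proof. by rewrite /total /rows exchange_big. Qed.

Let natr_inj0 (k : nat) (x : F) : k.+1%:R * x = 0 -> x = 0.
Proof. by move/eqP; rewrite mulf_eq0 pnatr_eq0 => /eqP. Qed.

(** Summing over j gives (m - 1) (total V - rows V 0) = 0. *)
Let row0_total V :
  (forall j, total V - rows V 0 - cols V j + V 0 j = 0) -> rows V 0 = total V.
Proof.
move=> h0; have : \sum_(j < m) (total V - rows V 0 - cols V j + V 0 j) = 0.
  by rewrite big1.
rewrite big_split /= !sumrB !sumr_const card_ord -/(rows V 0).
have -> : \sum_j cols V j = total V by rewrite -[RHS]total_tr.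
move=> eq0; apply/eqP; rewrite eq_sym -subr_eq0; apply/eqP; apply: (@natr_inj0 p.+1).
by rewrite -[RHS]eq0; ring.
Qed.

(** By [V 0 j = cols V j], the entries of column j outside row 0 sum to zero; summing the last
    hypothesis over i <> 0 then gives (m - 1) (total V - cols V j) = 0. *)
Let cols_total V :
  rows V 0 = total V -> (forall j, V 0 j = cols V j) ->
  (forall i j, i != 0 -> j != 0 ->
     2%:R * V i j = p.+1%:R * (total V - rows V i - cols V j)) ->
  forall j, j != 0 -> cols V j = total V.
Proof.
move=> R0 V0 Vij j j0.
have : \sum_(i < m | i != 0) (2%:R * V i j) = 0.
  have : cols V j = V 0 j + \sum_(i < m | i != 0) V i j by rewrite /cols (bigD1 0).
  rewrite V0 -mulr_sumr => /eqP.
  by rewrite addrC -subr_eq subrr => /eqP <-; rewrite mulr0.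
under eq_bigr do rewrite Vij //.
rewrite -mulr_sumr => /natr_inj0.
have : \sum_(i < m) (total V - rows V i - cols V j) = total V - rows V 0 - cols V j
    + \sum_(i < m | i != 0) (total V - rows V i - cols V j) by rewrite (bigD1 0).
rewrite !sumrB !sumr_const card_ord -/(total V) R0 => eq1 eq2.
rewrite eq2 addr0 in eq1.
apply/eqP; rewrite eq_sym -subr_eq0; apply/eqP; apply: (@natr_inj0 p.+1).
move/eqP: eq1; rewrite -subr_eq0 => /eqP <-.
by ring.
Qed.

Let kernel_total V :
  rows V 0 = total V -> cols V 0 = total V ->
  (forall j, V 0 j = cols V j) -> (forall i, V i 0 = rows V i) ->
  (forall i j, i != 0 -> j != 0 ->
     2%:R * V i j = p.+1%:R * (total V - rows V i - cols V j)) ->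
  forall i j, V i j = 0.
Proof.
move=> R0 C0 V0 V0' Vij.
have colsE j : cols V j = total V.
  by have [->//|] := eqVneq j 0; apply: cols_total.
have rowsE i : rows V i = total V.
  have [->//|i0] := eqVneq i 0; rewrite -[RHS]total_tr.
  apply: (@cols_total (tr V)) => //; first by rewrite total_tr.
  by move=> a b a0 b0; rewrite total_tr [LHS]Vij // addrAC.
(* All m row sums equal the total, so m times the total is the total. *)
have T0 : total V = 0.
  have : \sum_i rows V i = total V by [].
  under eq_bigr do rewrite rowsE.
  rewrite sumr_const card_ord => /eqP; rewrite -subr_eq0 mulrSr addrK => /eqP.
  by rewrite -mulr_natl; apply: natr_inj0.
move=> i j; have [->|i0] := eqVneq i 0; first by rewrite V0 colsE.
have [->|j0] := eqVneq j 0; first by rewrite V0' rowsE.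
by apply: (@natr_inj0 1); rewrite Vij // colsE rowsE T0 !subr0 mulr0.
Qed.

(** The weight depends only on coincidences among the indices and with 0, so the kernel equations
    involve only entries, row sums, column sums and the total of [V]. *)
Lemma mr_weight_kernel V :
  (forall i j, \sum_k \sum_l V k l * mr_weight F k l i j = 0) ->
  forall i j, V i j = 0.
Proof.
move=> ker.
have sum_i i : \sum_k \sum_l V k l * (k == i)%:R = rows V i.
  rewrite (bigD1 i) //= [X in _ + X]big1 ?addr0 => [|k /negbTE ne]; last first.
    by apply: big1 => l _; rewrite ne mulr0.
  by apply: eq_bigr => l _; rewrite eqxx mulr1.
have sum_j j : \sum_k \sum_l V k l * (l == j)%:R = cols V j.
  apply: eq_bigr => k _; rewrite (bigD1 j) //= big1 ?addr0 => [|l /negbTE ne]; last first.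
    by rewrite ne mulr0.
  by rewrite eqxx mulr1.
have sum_ij i j : \sum_k \sum_l V k l * ((k == i)%:R * (l == j)%:R) = V i j.
  rewrite (bigD1 i) //= [X in _ + X]big1 ?addr0 => [|k /negbTE ne]; last first.
    by apply: big1 => l _; rewrite ne mul0r mulr0.
  rewrite (bigD1 j) //= big1 ?addr0 => [|l /negbTE ne]; last first.
    by rewrite ne !mulr0.
  by rewrite !eqxx !mulr1.
have sum_off i j : \sum_k \sum_l V k l * (1 - (k == i)%:R - (l == j)%:R + (k == i)%:R * (l == j)%:R)
    = total V - rows V i - cols V j + V i j.
  rewrite -sum_i -sum_j -sum_ij -!sumrB -big_split /=; apply: eq_bigr => k _.
  rewrite -!sumrB -big_split /=; apply: eq_bigr => l _.
  by rewrite mulrDr !mulrBr mulr1.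
have off0 i j : (i == 0) || (j == 0) -> total V - rows V i - cols V j + V i j = 0.
  move=> ij0; apply: (@natr_inj0 p); rewrite -sum_off -[RHS](ker i j) mulr_sumr.
  apply: eq_bigr => k _; rewrite mulr_sumr; apply: eq_bigr => l _.
  rewrite /mr_weight; have -> : [|| k == 0, l == 0, i == 0 | j == 0].
    by rewrite ij0 !orbT.
  by case: (k == i); case: (l == j) => /=; ring.
have R0 : rows V 0 = total V by apply: row0_total => j; apply: off0.
have C0 : cols V 0 = total V.
  rewrite -[RHS]total_tr; apply: (@row0_total (tr V)) => j.
  by rewrite total_tr [X in X + _]addrAC; apply: off0; rewrite orbT.
have V0 j : V 0 j = cols V j.
  have := @off0 0 j isT; rewrite R0 subrr sub0r => /eqP.
  by rewrite addrC subr_eq0 => /eqP.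
have V0' i : V i 0 = rows V i.
  have := @off0 i 0; rewrite eqxx orbT C0 => /(_ isT) /eqP.
  by rewrite [total V - rows V i - _]addrAC subrr sub0r addrC subr_eq0 => /eqP.
apply: kernel_total => // i j i0 j0.
(* For i, j <> 0 and k <> i, l <> j, the weight is - 2 plus m on the cross k = 0 or l = 0, as p + 1
   = m - 2. This sum is the contribution of the cross. *)
have sum_cross : \sum_k \sum_l V k l * ((k == 0)%:R - (k == 0)%:R * (l == j)%:R
      + (l == 0)%:R - (k == i)%:R * (l == 0)%:R - (k == 0)%:R * (l == 0)%:R)
    = rows V 0 - V 0 j + cols V 0 - V i 0 - V 0 0.
  rewrite -sum_i -sum_j -!sum_ij -!sumrB -!(big_split, sumrB) /=; apply: eq_bigr => k _.
  rewrite -!sumrB -!(big_split, sumrB) /=; apply: eq_bigr => l _.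
  by rewrite !mulrBr mulrDr !mulrBr.
have : - 2%:R * (total V - rows V i - cols V j + V i j)
    + m%:R * (rows V 0 - V 0 j + cols V 0 - V i 0 - V 0 0) = 0.
  rewrite -sum_off -sum_cross !mulr_sumr -big_split -[RHS](ker i j) /=.
  apply: eq_bigr => k _; rewrite !mulr_sumr -big_split; apply: eq_bigr => l _ /=.
  rewrite /mr_weight (negbTE i0) (negbTE j0) !orbF.
  have [->|ki] /= := eqVneq k i.
    rewrite (negbTE i0); case: (l == j); case: (l == 0) => /=; ring.
  have [->|lj] /= := eqVneq l j.
    by rewrite (negbTE j0); case: (k == 0) => /=; ring.
  by case: (k == 0); case: (l == 0) => /=; ring.
rewrite V0 V0' V0 R0 C0 => eq0; apply/eqP; rewrite eq_sym -subr_eq0 -eq0.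
by apply/eqP; ring.
Qed.

Lemma det_mr_weight :
  \det (\matrix_(u, w) mr_weight F (mxvec_unindex u).1 (mxvec_unindex u).2
     (mxvec_unindex w).1 (mxvec_unindex w).2 : 'M[F]_(m * m)) != 0.
Proof.
apply/negP => /det0P[v v_neq0 v_ker]; case/eqP: v_neq0.
apply/rowP => u; rewrite mxE; case/mxvec_indexP: u => i j.
apply: (@mr_weight_kernel (fun k l => v 0 (mxvec_index k l))) => {}i {}j.
have /rowP/(_ (mxvec_index i j)) := v_ker; rewrite !mxE sum_mxvec => v_ij; rewrite -[RHS]v_ij.
by apply: eq_bigr => k _; apply: eq_bigr => l _; rewrite mxE !mxvec_indexK.
Qed.

End WeightKernel.

(** * Transfer to the padded permanent *)

Section PaddedPermanent.
Variables (F : numFieldType) (p : nat).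
Local Notation m := p.+3.
Local Notation perm := (perm_poly F m).

Lemma det_hess_perm_mr_point :
  (\det (hess_on 1%:M perm)).@[fun u => mr_point F p u 0] != 0.
Proof.
rewrite hess_onE map_mx1 trmx1 mul1mx mulmx1 -det_map_mx.
rewrite (_ : map_mx _ _ = (p`!)%:R *: \matrix_(u, w) mr_weight F (mxvec_unindex u).1
    (mxvec_unindex u).2 (mxvec_unindex w).1 (mxvec_unindex w).2).
  by rewrite detZ mulf_neq0 ?det_mr_weight // expf_neq0 // pnatr_eq0 -lt0n fact_gt0.
apply/matrixP=> u w; case/mxvec_indexP: u => i j; case/mxvec_indexP: w => k l.
by rewrite !mxE /= perm_poly_mr_hess !mxvec_indexK.
Qed.

Lemma dderX0 N (u : 'rV[F]_N) (q : {mpoly F[N]}) e :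
  dder u q = 0 -> dder u (q ^+ e) = 0.
Proof.
move=> dq; elim: e => [|e IHe]; last by rewrite exprS dderM dq IHe mul0r mulr0 addr0.
by rewrite expr0 /dder big1 // => i _; rewrite -mpolyC1 mderivC scaler0.
Qed.

Lemma padded_perm_hess n (f : {mpoly F[n * n]}) : padded_perm m f ->
  exists (W : 'M[F]_(m * m, n * n)) (x y : 'cV[F]_(n * n)),
    [/\ f.@[fun u => x u 0] = 0, f.@[fun u => y u 0] != 0
      & (\det (hess_on W f)).@[fun u => x u 0] != 0].
Proof.
have ones_neq0 : perm.@[fun=> 1] != 0.
  by rewrite perm_poly_ones pnatr_eq0 -lt0n fact_gt0.
case: n f / => [|n l A lt_mn /row_freeP[B lAB]].
  exists 1%:M, (mr_point F p), (const_mx 1); split.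
  - exact: perm_poly_mr_point.
  - by rewrite (meval_eq _ (v2 := fun=> 1)) // => u; rewrite mxE.
  exact: det_hess_perm_mr_point.
(* [B] is a right inverse of [col_mx l A]: the point [B *m col_mx 1%:M z] has l = 1 and matrix
   entries z. *)
have lB (z : 'cV[F]_(m * m)) : l *m (B *m col_mx 1%:M z) = 1%:M.
  have := congr1 (fun M => M *m col_mx 1%:M z) lAB; rewrite mul1mx -mulmxA mul_col_mx.
  by case/eq_col_mx.
have AB (z : 'cV[F]_(m * m)) : A *m (B *m col_mx 1%:M z) = z.
  have := congr1 (fun M => M *m col_mx 1%:M z) lAB; rewrite mul1mx -mulmxA mul_col_mx.
  by case/eq_col_mx.
have evalE z : (linear_form l ^+ (n - m) * linear_subst A perm).@[fun u => (B *m col_mx 1%:M z) u 0]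
    = perm.@[fun u => z u 0].
  rewrite mevalM rmorphXn /= linear_form_eval linear_subst_eval lB AB.
  by rewrite mxE eqxx expr1n mul1r.
(* These directions are dual to the matrix entries and killed by l, so the power of l behaves as a
   constant under differentiation. *)
pose W := (rsubmx B)^T.
have [lW AW] : l *m rsubmx B = 0 /\ A *m rsubmx B = 1%:M.
  have := congr1 rsubmx lAB; rewrite -[B in LHS]hsubmxK.
  rewrite mul_mx_row row_mxKr mul_col_mx scalar_mx_block block_mxEh row_mxKr.
  by case/eq_col_mx.
exists W, (B *m col_mx 1%:M (mr_point F p)), (B *m col_mx 1%:M (const_mx 1)); split.
- by rewrite evalE perm_poly_mr_point.
- by rewrite evalE (meval_eq _ (v2 := fun=> 1)) // => u; rewrite mxE.
set x := B *m _.
have d_l a : dder (row a W) (linear_form l) = 0.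
  rewrite dder_linear_form -row_mul -[_ *m l^T]trmxK trmx_mul trmxK /W trmxK lW.
  by rewrite trmx0 row0 mxE.
have -> : hess_on W (linear_form l ^+ (n - m) * linear_subst A perm) =
    linear_form l ^+ (n - m) *: map_mx (linear_subst A) (hess_on 1%:M perm).
  have -> : 1%:M = W *m A^T by rewrite -trmx_mul AW trmx1.
  rewrite -hess_on_linear_subst.
  by apply/matrixP=> a b; rewrite !mxE !dderM !dderX0 ?d_l // mul0r add0r dderM dderX0 ?d_l // mul0r add0r.
rewrite detZ mevalM rmorphXn rmorphXn /= linear_form_eval lB mxE eqxx !expr1n mul1r.
by rewrite det_map_mx linear_subst_eval AB det_hess_perm_mr_point.
Qed.

End PaddedPermanent.

(** * The lower bound *)

Lemma perm_in_det_closure_bound (F : numFieldType) (m n : nat) :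
  (0 < m <= n)%N -> perm_in_det_closure F m n -> (m * m <= n.*2)%N.
Proof.
case/andP=> m_gt0 le_mn [f f_perm f_cl].
rewrite leqNgt; apply/negP => lt_2n.
(* From 2n < m^2 and m <= n it follows that m > 2; so the bound is immediate for m <= 2. *)
have [p def_m] : exists p, m = p.+3.
  by exists (m - 3)%N; nia.
case: _ / (esym def_m) in m_gt0 le_mn lt_2n f_perm *.
have n1_neq0 : n.-1%:R != 0 :> F by rewrite pnatr_eq0; lia.
have [W [x [y [fx fy]]]] := padded_perm_hess f_perm; case/eqP.
apply: (closure_dvd_hess _ _ f_cl fx fy).
- exact: det_orbit_proj_point.
by move=> h; apply: det_orbit_dvd_hess.
Qed.

Theorem theorem1p0p1 (R : realType) (m : nat) (hm : (1 <= m)%N)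
    (n : nat) (hn : is_border_dc_perm (complex R) m n) :
  m%:R ^+ 2 / 2%:R <= n%:R :> R.
Proof.
have [le_mn m_in_cl _] := hn.
have := @perm_in_det_closure_bound (complex R) m n; rewrite hm le_mn => /(_ isT m_in_cl).
by rewrite ler_pdivrMr ?ltr0n // -natrX -natrM ler_nat muln2 mulnn.
Qed.
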